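(* Let $G$ be a 2-connected graph on $n$ vertices. If $G$ is $\{K_{1,3},P_7,D\}$-$f$-heavy or $\{K_{1,3},P_7,H\}$-$f$-heavy, then $G$ is Hamiltonian.
   Context: All graphs are finite and simple. For vertices $x,y$ of a subgraph $H$ of $G$, $d_H(x,y)$ is the length of a shortest $(x,y)$-path all of whose vertices lie in $H$; $d(v)$ denotes the degree of $v$ in $G$. An induced subgraph $H$ of $G$ (on $n$ vertices) is called $f$-heavy if for every pair of vertices $u,v\in V(H)$ with $d_H(u,v)=2$ we have $\max\{d(u),d(v)\}\geq n/2$. For a graph $R$, $G$ is $R$-$f$-heavy if every induced subgraph of $G$ isomorphic to $R$ is $f$-heavy; for a family $\mathcal{R}$ of graphs, $G$ is $\mathcal{R}$-$f$-heavy if it is $R$-$f$-heavy for every $R\in\mathcal{R}$. $K_{1,3}$ is the claw and $P_7$ is the path on 7 vertices. The deer $D$ is the graph on 7 vertices consisting of a triangle $abc$ together with two disjoint paths $b b_1 b_2$ and $c c_1 c_2$ (i.e., a triangle with a pendant path of length 2 attached at each of two of its vertices). The hourglass $H$ is the graph on 5 vertices consisting of two triangles sharing exactly one vertex. *)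

(* Defs.v *)
From mathcomp Require Import all_boot.
From Stdlib Require List.

Set Implicit Arguments.
Unset Strict Implicit.
Unset Printing Implicit Defensive.

Record sgraph := SGraph {
  vertex :> finType;
  adj : rel vertex;
  adj_sym : symmetric adj;
  adj_irr : irreflexive adj
}.

Definition deg (G : sgraph) (v : G) : nat := #|[set w | adj v w]|.

Section Induced.
Variables (G : sgraph) (S : {set G}).

Definition induced_adj : rel {x : G | x \in S} :=
  fun x y => adj (val x) (val y).

Lemma induced_sym : symmetric induced_adj.
Proof. by move=> x y; rewrite /induced_adj adj_sym. Qed.

Lemma induced_irr : irreflexive induced_adj.
Proof. by move=> x; rewrite /induced_adj adj_irr. Qed.

Definition induced : sgraph := SGraph induced_sym induced_irr.
End Induced.

Definition isomorphic (G H : sgraph) : Prop :=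
  exists2 f : G -> H, bijective f & forall x y, adj (f x) (f y) = adj x y.

(* The path is x :: p; its length (number of edges) is size p. *)
Definition is_path (G : sgraph) (x y : G) (p : seq G) : Prop :=
  [/\ path (@adj G) x p, last x p = y & uniq (x :: p)].

(* d_G(x, y) = k, as a relation since the distance may be infinite. *)
Definition is_dist (G : sgraph) (x y : G) (k : nat) : Prop :=
  (exists2 p, is_path x y p & size p = k) /\
  (forall p, is_path x y p -> k <= size p).

(* The distance is taken in G[S], the degrees and n = #|G| in G; the bound
   max{d(u), d(v)} >= n/2 is over the rationals, hence cleared of its
   denominator. *)
Definition fheavy_set (G : sgraph) (S : {set G}) : Prop :=
  forall u v : induced S, is_dist u v 2 ->
    #|G| <= 2 * maxn (deg (val u)) (deg (val v)).

Definition fheavy (R G : sgraph) : Prop :=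
  forall S : {set G}, isomorphic (induced S) R -> fheavy_set S.

Definition family_fheavy (Rs : seq sgraph) (G : sgraph) : Prop :=
  forall R, List.In R Rs -> fheavy R G.

Definition connected (G : sgraph) : Prop :=
  forall x y : G, connect (@adj G) x y.

Definition k_connected (k : nat) (G : sgraph) : Prop :=
  k < #|G| /\ forall X : {set G}, #|X| < k -> connected (induced (~: X)).

(* The size condition excludes a single edge traversed back and forth, which
   ucycle accepts as a cycle of length 2. *)
Definition hamiltonian (G : sgraph) : Prop :=
  exists c : seq G,
    [/\ 3 <= size c, ucycle (@adj G) c & forall x, x \in c].

Section EdgeList.
Variables (n : nat) (E : seq (nat * nat)).

Definition edges_adj : rel 'I_n := fun i j =>
  (i != j) && (((i : nat, j : nat) \in E) || ((j : nat, i : nat) \in E)).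

Lemma edges_sym : symmetric edges_adj.
Proof. by move=> i j; rewrite /edges_adj eq_sym orbC. Qed.

Lemma edges_irr : irreflexive edges_adj.
Proof. by move=> i; rewrite /edges_adj eqxx. Qed.

Definition graph_of_edges : sgraph := SGraph edges_sym edges_irr.
End EdgeList.

Definition claw : sgraph := graph_of_edges 4 [:: (0, 1); (0, 2); (0, 3)].

Definition P7 : sgraph :=
  graph_of_edges 7 [:: (0, 1); (1, 2); (2, 3); (3, 4); (4, 5); (5, 6)].

(* a, b, c = 0, 1, 2; b1, b2 = 3, 4; c1, c2 = 5, 6. *)
Definition deer : sgraph :=
  graph_of_edges 7
    [:: (0, 1); (0, 2); (1, 2); (1, 3); (3, 4); (2, 5); (5, 6)].

Definition hourglass : sgraph :=
  graph_of_edges 5 [:: (0, 1); (0, 2); (1, 2); (0, 3); (0, 4); (3, 4)].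

(* Main.v *)
Require Import Defs.
From mathcomp Require Import all_boot.
From mathcomp Require Import zify.

Set Implicit Arguments.
Unset Strict Implicit.
Unset Printing Implicit Defensive.

(* Call a vertex heavy if its degree is at least n/2, and let [hadj] be
   adjacency with all pairs of heavy vertices joined.  By Ore's crossing
   argument the vertices of an [hadj]-cycle lie on a cycle of G.  Let C be a
   longest cycle of G containing all heavy vertices, and suppose it misses a
   vertex; then some path x1 z ... x2 with x1, x2 on C has its interior, free of
   heavy vertices, off C.  The claw condition makes the two C-neighbours of x1
   [hadj]-adjacent, and likewise for x2.  Let y1 be the first vertex after x1 on
   C that is not adjacent to x1, and u1 its predecessor; define y2 and u2
   similarly.  Rerouting C shows that the two sides are not joined by [hadj].
   If x1 and x2 are nonadjacent, a shortest such path extended by u1 y1 and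
   u2 y2 contains an induced P7.  If they are adjacent, the claw condition makes
   z adjacent to both, and z x1 u1 y1 x2 u2 y2 is a deer, while x1 (or x2) is
   the centre of an hourglass made of z, x1, x2 and C-neighbours.  As z is not
   heavy, u1 and u2 would both have to be heavy, hence [hadj]-adjacent. *)

(** * Heavy vertices and adjacency up to heavy pairs *)

Definition heavy (G : sgraph) (v : G) : bool := #|G| <= 2 * deg v.

Definition hadj (G : sgraph) : rel G :=
  fun x y => adj x y || [&& x != y, heavy x & heavy y].

Lemma adj_hadj (G : sgraph) : subrel (@adj G) (@hadj G).
Proof. by move=> x y xy; rewrite /hadj xy. Qed.

Lemma hadj_sym (G : sgraph) : symmetric (@hadj G).
Proof.
by move=> x y; rewrite /hadj adj_sym eq_sym [heavy x && _]andbC.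
Qed.

Lemma heavy_hadj (G : sgraph) (x y : G) :
  x != y -> heavy x -> heavy y -> hadj x y.
Proof. by move=> xy hx hy; rewrite /hadj xy hx hy orbT. Qed.

Lemma hadjN_adj (G : sgraph) (x y : G) : ~~ hadj x y -> adj x y = false.
Proof. by move=> /negP h; apply/negP => /adj_hadj. Qed.

Lemma adj_neq (G : sgraph) (x y : G) : adj x y -> x != y.
Proof. by apply: contraTneq => ->; rewrite adj_irr. Qed.

(** * Heavy vertices forced by induced copies of the four graphs *)

(** The image of [f] induces a copy of [R], in which [f i] and [f j] are at distance exactly 2
    through [f k]. *)
Lemma fheavy_embed (R G : sgraph) (f : R -> G) :
  fheavy R G -> injective f -> (forall x y, adj (f x) (f y) = adj x y) ->
  forall i k j, adj i k -> adj k j -> ~~ adj i j -> i != j ->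
  heavy (f i) || heavy (f j).
Proof.
move=> hR finj fadj i k j ik kj nij dij.
pose S := [set f x | x in R].
have fS x : f x \in S by apply: imset_f.
pose g x : induced S := exist _ (f x) (fS x).
have ginj : injective g by move=> x y /(congr1 val) /finj.
have gsurj (y : induced S) : exists x, g x == y.
  case: y => y yS; have /imsetP[x _ yx] := yS.
  by exists x; apply/eqP/val_inj.
pose h y := xchoose (gsurj y).
have hK : cancel h g by move=> y; apply/eqP/(xchooseP (gsurj y)).
have gK : cancel g h by move=> x; apply: ginj; rewrite hK.
have iso : isomorphic (induced S) R.
  exists h; first by exists g.
  by move=> x y; rewrite -fadj -{2}(hK x) -{2}(hK y).
have gadj x y : induced_adj (g x) (g y) = adj x y by rewrite -fadj.
have := hR S iso (g i) (g j); rewrite /= => hd.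
have : #|G| <= 2 * maxn (deg (f i)) (deg (f j)).
  apply: hd; split.
    exists [:: g k; g j] => //; split=> //=.
    - by rewrite !gadj ik kj.
    - rewrite !inE !(inj_eq ginj) negb_or dij andbT andbT.
      by rewrite (adj_neq ik) (adj_neq kj).
  case=> [|a [|b p]] //.
  - by case=> _ /= /ginj ijE; rewrite ijE eqxx in dij.
  - by case=> /=; rewrite andbT => ia ae; rewrite ae gadj (negbTE nij) in ia.
by rewrite /heavy; lia.
Qed.

(** Listing the vertices of the copy turns inducedness into a finite check over index pairs [i < j];
    hence all edges in [E] point upwards. *)
Lemma fheavy_edges (G : sgraph) n E (x0 : G) s :
  fheavy (graph_of_edges n E) G -> uniq s -> size s = n ->
  all (fun e : nat * nat => e.1 < e.2) E ->
  (forall i j, i < j -> j < n ->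
     adj (nth x0 s i) (nth x0 s j) = ((i, j) \in E)) ->
  forall i k j, i < n -> k < n -> j < n ->
  ((i, k) \in E) || ((k, i) \in E) -> ((k, j) \in E) || ((j, k) \in E) ->
  ~~ (((i, j) \in E) || ((j, i) \in E)) -> i != j ->
  heavy (nth x0 s i) || heavy (nth x0 s j).
Proof.
move=> hR us ss /allP/= ltE adjE i k j lin lkn ljn ik kj ij dij.
pose f (a : graph_of_edges n E) : G := nth x0 s (val (a : 'I_n)).
have neqE a b : ((a, b) \in E) || ((b, a) \in E) -> a != b.
  by case/orP => /ltE /=; rewrite neq_ltn => ->; rewrite ?orbT.
have finj : injective f.
  move=> a b /eqP; rewrite nth_uniq ?ss ?ltn_ord // => /eqP ab.
  exact: val_inj.
have fadj a b : adj (f a) (f b) = adj a b.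
  rewrite /f /=/edges_adj -val_eqE /=.
  have ltF c d : c < d -> ((d, c) \in E) = false.
    by move=> cd; apply/negP => /ltE /=; rewrite ltnNge ltnW.
  case: (ltngtP (val (a : 'I_n)) (val (b : 'I_n))) => ab /=.
  - by rewrite adjE ?ltn_ord // (ltF _ _ ab) orbF.
  - by rewrite adj_sym adjE ?ltn_ord // (ltF _ _ ab).
  - by rewrite ab adj_irr.
apply: (fheavy_embed hR finj fadj (i := Ordinal lin) (k := Ordinal lkn)
         (j := Ordinal ljn)) => //=.
- by rewrite /edges_adj -val_eqE /= neqE.
- by rewrite /edges_adj -val_eqE /= neqE.
- by rewrite /edges_adj -val_eqE /= negb_and (negbTE ij) orbT.
Qed.

(** If [b] and [d] are nonadjacent, the claw is induced; the light vertex [a] is at distance 2 from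
    both, so both are heavy. *)
Lemma claw_hadj (G : sgraph) (c a b d : G) :
  fheavy claw G -> ~~ heavy a -> adj c a -> adj c b -> adj c d ->
  b != d -> a != b -> a != d -> ~~ adj a b -> ~~ adj a d -> hadj b d.
Proof.
move=> hC na ca cb cd bd ab ad nab nad.
have [/adj_hadj //|nbd] := boolP (adj b d).
have us : uniq [:: c; a; b; d].
  by rewrite /= !inE !negb_or ab ad bd (adj_neq ca) (adj_neq cb) (adj_neq cd).
have adjE i j : i < j -> j < 4 ->
   adj (nth c [:: c; a; b; d] i) (nth c [:: c; a; b; d] j)
     = ((i, j) \in [:: (0, 1); (0, 2); (0, 3)]).
  case: i => [|[|[|[|i]]]]; case: j => [|[|[|[|j]]]] //= _ _;
    by rewrite ?ca ?cb ?cd ?(negbTE nab) ?(negbTE nad) ?(negbTE nbd).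
have hv := fheavy_edges hC us erefl erefl adjE.
have hb := hv 1 0 2 erefl erefl erefl erefl erefl erefl erefl.
have hd := hv 1 0 3 erefl erefl erefl erefl erefl erefl erefl.
by move: hb hd; rewrite /= (negbTE na) /=; apply: heavy_hadj.
Qed.

(** The first two pairs serve ears with one interior vertex, the first and third those with two, the
    second all longer ones. *)
Lemma P7_heavy (G : sgraph) (v1 v2 v3 v4 v5 v6 v7 : G) :
  fheavy P7 G -> uniq [:: v1; v2; v3; v4; v5; v6; v7] ->
  [&& adj v1 v2, adj v2 v3, adj v3 v4, adj v4 v5, adj v5 v6 & adj v6 v7] ->
  ~~ [|| adj v1 v3, adj v1 v4, adj v1 v5, adj v1 v6 | adj v1 v7] ->
  ~~ [|| adj v2 v4, adj v2 v5, adj v2 v6 | adj v2 v7] ->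
  ~~ [|| adj v3 v5, adj v3 v6 | adj v3 v7] ->
  ~~ [|| adj v4 v6, adj v4 v7 | adj v5 v7] ->
  [/\ heavy v2 || heavy v4, heavy v4 || heavy v6 & heavy v5 || heavy v7].
Proof.
move=> hP us /and5P[a12 a23 a34 a45 /andP[a56 a67]].
rewrite !negb_or => /and5P[n13 n14 n15 n16 n17] /and4P[n24 n25 n26 n27].
move=> /and3P[n35 n36 n37] /and3P[n46 n47 n57].
set s := [:: v1; v2; v3; v4; v5; v6; v7] in us.
have adjE i j : i < j -> j < 7 -> adj (nth v1 s i) (nth v1 s j)
   = ((i, j) \in [:: (0, 1); (1, 2); (2, 3); (3, 4); (4, 5); (5, 6)]).
  by case: i => [|[|[|[|[|[|[|i]]]]]]]; case: j => [|[|[|[|[|[|[|j]]]]]]] //= _ _;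
    rewrite ?a12 ?a23 ?a34 ?a45 ?a56 ?a67; first [done | exact/negbTE].
have hv := fheavy_edges hP us erefl erefl adjE.
split.
- exact: (hv 1 2 3).
- exact: (hv 3 4 5).
- exact: (hv 4 5 6).
Qed.

Lemma deer_heavy (G : sgraph) (a b c b1 b2 c1 c2 : G) :
  fheavy deer G -> uniq [:: a; b; c; b1; b2; c1; c2] ->
  [&& adj a b, adj a c & adj b c] ->
  [&& adj b b1, adj b1 b2, adj c c1 & adj c1 c2] ->
  ~~ [|| adj a b1, adj a b2, adj a c1 | adj a c2] ->
  ~~ [|| adj b b2, adj b c1 | adj b c2] ->
  ~~ [|| adj c c2, adj c b1 | adj c b2] ->
  ~~ [|| adj b1 c1, adj b1 c2, adj b2 c1 | adj b2 c2] ->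
  (heavy a || heavy b1) && (heavy a || heavy c1).
Proof.
move=> hD us /and3P[ab ac bc] /and4P[bb1 b12 cc1 c12].
rewrite !negb_or => /and4P[n1 n2 n3 n4] /and3P[n5 n6 n7] /and3P[n8 n9 n10].
move=> /and4P[n11 n12 n13 n14].
set s := [:: a; b; c; b1; b2; c1; c2] in us.
have adjE i j : i < j -> j < 7 -> adj (nth a s i) (nth a s j)
   = ((i, j) \in [:: (0, 1); (0, 2); (1, 2); (1, 3); (3, 4); (2, 5); (5, 6)]).
  by case: i => [|[|[|[|[|[|[|i]]]]]]]; case: j => [|[|[|[|[|[|[|j]]]]]]] //= _ _;
    rewrite ?ab ?ac ?bc ?bb1 ?b12 ?cc1 ?c12; first [done | exact/negbTE].
have hv := fheavy_edges hD us erefl erefl adjE.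
by apply/andP; split; [exact: (hv 0 1 3) | exact: (hv 0 2 5)].
Qed.

Lemma hourglass_heavy (G : sgraph) (c a b d e : G) :
  fheavy hourglass G -> uniq [:: c; a; b; d; e] ->
  [&& adj c a, adj c b, adj a b, adj c d & adj c e] -> adj d e ->
  ~~ [|| adj a d, adj a e, adj b d | adj b e] ->
  heavy a || heavy d.
Proof.
move=> hH us /and5P[ca cb ab cd ce] de.
rewrite !negb_or => /and4P[n1 n2 n3 n4].
set s := [:: c; a; b; d; e] in us.
have adjE i j : i < j -> j < 5 -> adj (nth c s i) (nth c s j)
   = ((i, j) \in [:: (0, 1); (0, 2); (1, 2); (0, 3); (0, 4); (3, 4)]).
  by case: i => [|[|[|[|[|i]]]]]; case: j => [|[|[|[|[|j]]]]] //= _ _;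
    rewrite ?ca ?cb ?ab ?cd ?ce ?de; first [done | exact/negbTE].
exact: (fheavy_edges hH us erefl erefl adjE (i := 1) (k := 0) (j := 3)).
Qed.

(** * Ore's crossing argument: from [hadj]-cycles to cycles of G *)

Lemma path_rev_cons (T : Type) (e : rel T) (x y : T) s :
  symmetric e -> path e x (rev (y :: s)) = e x (last y s) && path e y s.
Proof.
move=> esym; elim/last_ind: s x => [|s z IHs] x; first by rewrite /= andbT.
rewrite -rcons_cons rev_rcons [path _ _ (z :: _)]/= IHs last_rcons.
by rewrite rcons_path [e z _]esym; congr (_ && _); rewrite andbC.
Qed.

Lemma last_rev_cons (T : Type) (x y : T) s : last x (rev (y :: s)) = y.
Proof. by rewrite rev_cons last_rcons. Qed.

(** The lists [belast x s] and [s] hold the first and second entries of the [size s] consecutive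
    pairs; without a crossing, each pair is counted at most once. *)
Lemma crossing_or_count (T : Type) (a b : pred T) x (s : seq T) :
  (exists s1 z s2, [/\ s = s1 ++ z :: s2, b (last x s1) & a z]) \/
  count a s + count b (belast x s) <= size s.
Proof.
elim: s x => [|y s IHs] x; first by right.
have [/andP[bx ay]|nxy] := boolP (b x && a y).
  by left; exists [::], y, s.
case: (IHs y) => [[s1 [z [s2 [-> bz az]]]]|le].
  by left; exists (y :: s1), z, s2.
by right; rewrite /=; move: nxy le; case: (b x); case: (a y) => //= _; lia.
Qed.

(* Ore's crossing argument, where a common neighbour off the path may also be
   used to close it. *)
Lemma close_heavy_path (G : sgraph) (e : rel G) u p :
  subrel (@adj G) e -> symmetric e -> uniq (u :: p) -> path e u p ->
  heavy u -> heavy (last u p) -> ~~ adj u (last u p) ->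
  exists c, [/\ uniq c, cycle e c & {subset u :: p <= c}].
Proof.
move=> sube esym up ep hu hv nuv; set v := last u p in hv nuv *.
have [/existsP[w /and3P[wp uw wv]]|now] :=
  boolP [exists w, [&& w \notin u :: p, adj u w & adj w v]].
  exists (w :: u :: p); split.
  - by rewrite cons_uniq wp.
  - by rewrite /= rcons_path -/v ep /=; apply/andP; split; apply: sube;
      rewrite adj_sym.
  - by move=> x xp; rewrite inE xp orbT.
case: (crossing_or_count (@adj G u) (@adj G v) u p) => [|le].
  case=> s1 [z [s2 [pE va uz]]].
  (* The step from [last u s1] to [z] gives way to the edges from [last u s1] to [v] and from [z] to
     [u]. *)
  exists (u :: s1 ++ rev (z :: s2)).
  have pm : perm_eq (u :: s1 ++ rev (z :: s2)) (u :: p).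
    by rewrite pE perm_cons perm_cat2l perm_rev.
  split; first by rewrite (perm_uniq pm).
  - have vE : v = last z s2 by rewrite /v pE last_cat.
    move: ep; rewrite pE cat_path /= => /and3P[e1 _ e2].
    rewrite rcons_cat cat_path e1 rcons_path path_rev_cons // last_rev_cons e2.
    rewrite andbT /=; apply/andP; split; apply: sube; last by rewrite adj_sym.
    by rewrite -vE adj_sym.
  - by move=> x; rewrite (perm_mem pm).
(* The neighbours on the path number at most [size p] in total, and those off it form disjoint
   subsets of the complement, which has [#|G| - size p - 1] elements. So the degrees sum to less
   than [#|G|], against heaviness. *)
pose L := [set x in u :: p].
have cu : #|[set w | adj u w] :&: L| = count (@adj G u) p.
  have -> : count (@adj G u) p = count (@adj G u) (u :: p) by rewrite /= adj_irr.
  rewrite -size_filter -(card_uniqP (filter_uniq _ up)) -cardsE.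
  by apply: eq_card => x; rewrite !inE mem_filter inE.
have cv : #|[set w | adj v w] :&: L| = count (@adj G v) (belast u p).
  have -> : count (@adj G v) (belast u p) = count (@adj G v) (u :: p).
    by rewrite lastI -cats1 count_cat /= -/v adj_irr !addn0.
  rewrite -size_filter -(card_uniqP (filter_uniq _ up)) -cardsE.
  by apply: eq_card => x; rewrite !inE mem_filter inE.
have cL : #|L| = size (u :: p) by rewrite -(card_uniqP up) cardsE.
have dis : [disjoint [set w | adj u w] :\: L & [set w | adj v w] :\: L].
  rewrite -setI_eq0; apply/eqP/setP=> w; rewrite !inE.
  apply/negP => /andP[/andP[wL uw] /andP[_ vw]].
  move/negP: now; apply; apply/existsP; exists w.
  by rewrite inE wL uw adj_sym.
have : #|[set w | adj u w] :\: L| + #|[set w | adj v w] :\: L| <= #|~: L|.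
  rewrite -(eqP (etrans (leq_card_setU _ _).2 dis)).
  apply: subset_leq_card; apply/subsetP=> x.
  by rewrite !inE => /orP[] /andP[].
move: hu hv; rewrite /heavy /deg.
rewrite -(cardsID L [set w | adj u w]) -(cardsID L [set w | adj v w]) cu cv.
by move: (cardsC L); rewrite cL /=; move: le; lia.
Qed.

(** Keeping the added pairs in a list allows removing them one at a time. *)
Definition add_pairs (G : sgraph) (F : seq (G * G)) : rel G :=
  fun x y => adj x y || ((x, y) \in F) || ((y, x) \in F).

Lemma add_pairs_sym (G : sgraph) (F : seq (G * G)) : symmetric (add_pairs F).
Proof.
by move=> x y; rewrite /add_pairs adj_sym -!orbA; congr (_ || _); rewrite orbC.
Qed.

(** Induction on [F]: if the cycle uses the first pair, deleting that step leaves a path with heavy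
    ends, which [close_heavy_path] closes again without losing vertices. *)
Lemma add_pairs_cycle (G : sgraph) (F : seq (G * G)) c :
  all (fun f => [&& f.1 != f.2, heavy f.1 & heavy f.2]) F ->
  2 < size c -> uniq c -> cycle (add_pairs F) c ->
  exists c', [/\ uniq c', cycle (@adj G) c' & {subset c <= c'}].
Proof.
elim: F c => [|[u v] F IH] c /=.
  move=> _ _ uc cc; exists c; split=> //.
  by apply: sub_cycle cc => x y; rewrite /add_pairs !in_nil !orbF.
move=> /andP[/and3P[/= duv hu hv] hF] sc uc cc.
suff [c' [uc' cc' sub]] :
    exists c', [/\ uniq c', cycle (add_pairs F) c' & {subset c <= c'}].
  have sc' : 2 < size c' by apply: leq_trans sc (uniq_leq_size uc sub).
  have [c'' [u'' cc'' sub']] := IH c' hF sc' uc' cc'.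
  by exists c''; split=> // x /sub /sub'.
have [cF|] := boolP (cycle (add_pairs F) c); first by exists c; split.
move=> ncF.
have /hasP[x xc nx] : has (fun x => ~~ add_pairs F x (next c x)) c.
  apply: contraNT ncF => /hasPn h; apply: cycle_from_next => // x xc.
  by have := h x xc; rewrite negbK.
set y := next c x in nx.
have exy := next_cycle cc xc; rewrite -/y in exy.
have xyF : (((x, y) == (u, v)) || ((x, y) == (v, u))).
  move: exy nx; rewrite /add_pairs !inE !negb_or => exy /andP[/andP[n1 n2] n3].
  move: exy; rewrite (negbTE n1) (negbTE n2) (negbTE n3) !orbF /=.
  by rewrite !xpair_eqE [(y == u) && _]andbC.
have [hx hy dxy] : [/\ heavy x, heavy y & x != y].
  by case/orP: xyF => /eqP[-> ->]; split=> //; rewrite eq_sym.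
have [i p0 rc0] := rot_to xc.
(* After rotation the step from [x] to [y] is the closing one, so deleting it leaves the path
   [y :: p]. *)
have [p rc lastp] : exists2 p, rot 1 (rot i c) = y :: p & last y p = x.
  case: p0 rc0 => [|y' q] rc0.
    by move: sc; rewrite -(size_rot i) rc0.
  have yE : y = y' by rewrite /y -(next_rot i uc) rc0 /= eqxx.
  by exists (rcons q x); rewrite ?last_rcons // rc0 rot1_cons yE.
have ryp : uniq (y :: p) by rewrite -rc !rot_uniq.
have cyp : cycle (add_pairs ((u, v) :: F)) (y :: p) by rewrite -rc !rot_cycle.
have psub : {subset c <= y :: p} by move=> w; rewrite -rc !mem_rot.
clearbody y.
(* The pair [x], [y] does not recur: the first step leads to some [h != x], since the cycle has more
   than two vertices, and later steps avoid [y]. *)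
have pF : path (add_pairs F) y p.
  have : size (y :: p) = size c by rewrite -rc !size_rot.
  move: cyp => /=; rewrite rcons_path => /andP[cyp _] sp.
  clear rc psub; case: p ryp lastp cyp sp => [|h p] // ryp lastp.
  move=> /= /andP[yh hp] sp.
  have yF w : y != w -> x != w -> add_pairs ((u, v) :: F) y w -> add_pairs F y w.
    rewrite /add_pairs !inE => yw xw /orP[/orP[->//|]|].
      case/orP=> [/eqP[? ?]|->]; last by rewrite orbT.
      by case/orP: xyF => /eqP[? ?]; subst; rewrite eqxx in yw xw.
    case/orP=> [/eqP[? ?]|->]; last by rewrite !orbT.
    by case/orP: xyF => /eqP[? ?]; subst; rewrite eqxx in yw xw.
  have hxx : x != h.
    apply/eqP => xh; move: ryp lastp sp; rewrite xh => /and3P[_ hnp _].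
    case: (p) hnp sc => [|k q] hnp sc /= lk; first by move=> E; rewrite -E in sc.
    by rewrite -{1}lk mem_last in hnp.
  have yh' : y != h by case/andP: ryp; rewrite inE negb_or => /andP[].
  rewrite yF //=.
  apply: (@sub_in_path _ [pred w | w != y] _ _ _ _ _ _ hp); last first.
    by apply/allP=> w wp /=; case/andP: ryp => + _; apply: contra => /eqP <-.
  move=> a b; rewrite !inE /add_pairs !inE => ay yb.
  case/orP=> [/orP[->//|]|].
    case/orP=> [/eqP[? ?]|->]; last by rewrite orbT.
    by case/orP: xyF => /eqP[? ?]; subst; rewrite eqxx in ay yb.
  case/orP=> [/eqP[? ?]|->]; last by rewrite !orbT.
  by case/orP: xyF => /eqP[? ?]; subst; rewrite eqxx in ay yb.
have sube : subrel (@adj G) (add_pairs F).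
  by move=> a b ab; rewrite /add_pairs ab.
have nadj : ~~ adj y (last y p).
  by rewrite lastp adj_sym; apply: contra nx => /sube.
rewrite -lastp in hx.
have [c' [uc' cc' sub]] :=
  close_heavy_path sube (@add_pairs_sym G F) ryp pF hy hx nadj.
by exists c'; split=> // w /psub /sub.
Qed.

Lemma hadj_cycle (G : sgraph) (c : seq G) :
  2 < size c -> uniq c -> cycle (@hadj G) c ->
  exists c', [/\ uniq c', cycle (@adj G) c' & {subset c <= c'}].
Proof.
move=> sc uc cc.
pose F := [seq f <- enum {: G * G} | [&& f.1 != f.2, heavy f.1 & heavy f.2]].
apply: (add_pairs_cycle (F := F)) => //; first exact: filter_all.
apply: sub_cycle cc => x y; rewrite /hadj /add_pairs => /orP[->//|h].
by rewrite mem_filter /= h mem_enum !orbT.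
Qed.

(** * Reroutings of a cycle that cannot be extended *)

(** Maximality is phrased with [hadj] so that reroutings may use heavy pairs as edges; only the
    vertex set of [W] matters. *)
Definition no_extension (G : sgraph) (W : seq G) : Prop :=
  forall c z, uniq c -> cycle (@hadj G) c -> {subset W <= c} ->
  z \in c -> z \in W.

Lemma no_extension_cycle (G : sgraph) (W s c : seq G) :
  no_extension W -> uniq (W ++ s) -> 0 < size s -> perm_eq c (W ++ s) ->
  ~~ cycle (@hadj G) c.
Proof.
move=> ne uWs s0 pc; apply/negP => cc; case: s s0 uWs pc => // z s _ uWs pc.
have : z \in W.
  apply: (ne c) => //; first by rewrite (perm_uniq pc).
    by move=> w wW; rewrite (perm_mem pc) mem_cat wW.
  by rewrite (perm_mem pc) mem_cat mem_head orbT.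
by move: uWs; rewrite cat_uniq /= => /and3P[_ /norP[/negbTE ->]].
Qed.

Lemma eq_no_extension (G : sgraph) (W W' : seq G) :
  W =i W' -> no_extension W -> no_extension W'.
Proof.
move=> eW ne c z uc cc sub zc; rewrite -eW; apply: (ne c) => // w.
by rewrite eW => /sub.
Qed.

Definition ear (G : sgraph) (W : seq G) (x : G) s y : Prop :=
  [/\ 0 < size s, uniq (W ++ s), path (@adj G) x s & adj (last x s) y].

Lemma ear_rev (G : sgraph) (W W' : seq G) (x y : G) s :
  perm_eq W W' -> ear W x s y -> ear W' y (rev s) x.
Proof.
move=> pW [s0 us ps ly]; split; first by rewrite size_rev.
- rewrite (perm_uniq (s2 := W ++ s)) //.
  by rewrite perm_sym; apply: perm_cat => //; rewrite perm_sym perm_rev.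
- case: s s0 ps ly {us} => // z s _ /= /andP[xz zs] sy.
  by rewrite (path_rev_cons _ _ _ (@adj_sym G)) zs andbT adj_sym.
- case: s s0 ps {us ly} => // z s _ /= /andP[xz _].
  by rewrite last_rev_cons adj_sym.
Qed.

(* The chord from the last vertex of A1 (A2) to u2 (u1) lets the cycle bypass
   x2 (x1). *)
Definition frame (G : sgraph) (x1 u1 y1 : G) A1 (x2 u2 y2 : G) A2 : Prop :=
  [/\ [/\ adj x1 u1, adj u1 y1, path (@hadj G) y1 A1,
          adj (last y1 A1) x2 & hadj (last y1 A1) u2],
      [/\ adj x2 u2, adj u2 y2, path (@hadj G) y2 A2,
          adj (last y2 A2) x1 & hadj (last y2 A2) u1]
    & no_extension ([:: x1, u1, y1 & A1] ++ [:: x2, u2, y2 & A2])].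

Lemma frame_swap (G : sgraph) (x1 u1 y1 x2 u2 y2 : G) A1 A2 :
  frame x1 u1 y1 A1 x2 u2 y2 A2 -> frame x2 u2 y2 A2 x1 u1 y1 A1.
Proof.
case=> ? ? ne; split=> //; apply: eq_no_extension ne.
by apply: perm_mem; rewrite perm_catC.
Qed.

(** Permutations are compared by counts, which become a linear identity once the booleans are
    generalised to numbers. *)
Ltac perm_tac :=
  apply/permP => ?; repeat (progress rewrite ?(count_cat, count_rev) /=);
  repeat match goal with |- context [nat_of_bool ?b] =>
    move: (nat_of_bool b) => ? end;
  clear; lia.

(** A rerouting concatenates known paths, some reversed, so what remains are the joins, each a
    hypothesis up to symmetry. *)
Ltac cycle_tac :=
  rewrite /= ?(rcons_cat, rcons_cons) /=;
  repeat (progress rewrite ?(cat_path, rcons_path, last_cat, last_rcons,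
    path_rev_cons _ _ _ (@hadj_sym _), last_rev_cons) /=);
  repeat (apply/andP; split);
  first [done | assumption | by rewrite hadj_sym].

(** Each chord would close the ear and both sides into one [hadj]-cycle, with sides reversed or
    bypass chords used as needed; the explicit lists give its order. *)
Lemma frame_exchange (G : sgraph) (x1 u1 y1 x2 u2 y2 : G) A1 A2 s :
  frame x1 u1 y1 A1 x2 u2 y2 A2 ->
  ear ([:: x1, u1, y1 & A1] ++ [:: x2, u2, y2 & A2]) x1 s x2 ->
  [/\ ~~ hadj u1 u2, ~~ hadj x1 u2, ~~ hadj y1 x2, ~~ hadj y1 u2
    & ~~ hadj y1 y2 /\ ~~ hadj x2 (last y2 A2)].
Proof.
case=> [[/adj_hadj xu1 /adj_hadj uy1 p1 /adj_hadj l1 k1]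
        [/adj_hadj xu2 /adj_hadj uy2 p2 /adj_hadj l2 k2] ne].
case=> s0 us ps /adj_hadj ls.
have {}ps : path (@hadj G) x1 s := sub_path (@adj_hadj G) ps.
have noc := no_extension_cycle ne us s0.
split; last split; apply/negP => bad.
- have /negP[] := noc
    (x1 :: s ++ x2 :: rev (y1 :: A1) ++ [:: u1, u2, y2 & A2]) ltac:(perm_tac).
  cycle_tac.
- have /negP[] := noc
    (x1 :: s ++ x2 :: rev (y1 :: A1) ++ u1 :: rev (y2 :: A2) ++ [:: u2])
    ltac:(perm_tac).
  cycle_tac.
- have /negP[] := noc
    (x1 :: s ++ [:: x2, y1 & A1] ++ [:: u2, y2 & A2] ++ [:: u1])
    ltac:(perm_tac).
  cycle_tac.
- have /negP[] := noc
    (x1 :: s ++ x2 :: rev (y1 :: A1) ++ [:: u2, y2 & A2] ++ [:: u1])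
    ltac:(perm_tac).
  cycle_tac.
- have /negP[] := noc
    (x1 :: s ++ [:: x2; u2] ++ rev (y1 :: A1) ++ (y2 :: A2) ++ [:: u1])
    ltac:(perm_tac).
  cycle_tac.
- have /negP[] := noc
    (x1 :: s ++ x2 :: rev (y2 :: A2) ++ u2 :: rev (y1 :: A1) ++ [:: u1])
    ltac:(perm_tac).
  cycle_tac.
Qed.

(** The initial part of the ear up to [z], followed by the supposed edge, already yields a cycle
    through the frame and [z]. *)
Lemma frame_ear_vertex (G : sgraph) (x1 u1 y1 x2 u2 y2 : G) A1 A2 s z :
  frame x1 u1 y1 A1 x2 u2 y2 A2 ->
  ear ([:: x1, u1, y1 & A1] ++ [:: x2, u2, y2 & A2]) x1 s x2 ->
  z \in s -> [/\ ~~ adj z u1, ~~ adj z y1 & ~~ adj z (last y2 A2)].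
Proof.
case=> [[/adj_hadj xu1 /adj_hadj uy1 p1 /adj_hadj l1 k1]
        [/adj_hadj xu2 /adj_hadj uy2 p2 /adj_hadj l2 k2] ne].
case=> _ us ps _ zs.
case/splitPr: zs us ps => s1 s2 us ps.
have {ps} ps : path (@hadj G) x1 (rcons s1 z).
  apply: (sub_path (@adj_hadj G)).
  by move: ps; rewrite cat_path rcons_path /= => /and3P[-> -> _].
have {us} us :
    uniq (([:: x1, u1, y1 & A1] ++ [:: x2, u2, y2 & A2]) ++ rcons s1 z).
  move: us; rewrite -[s1 ++ _]cat_rcons catA [uniq (_ ++ s2)]cat_uniq.
  by case/andP.
have noc := no_extension_cycle ne us ltac:(by rewrite size_rcons).
move: (rcons s1 z) (last_rcons x1 s1 z) ps us noc => r ls ps us noc.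
split; apply/negP => /adj_hadj; rewrite -ls => bad.
- have /negP[] := noc
    (x1 :: r ++ [:: u1, y1 & A1] ++ [:: x2, u2, y2 & A2]) ltac:(perm_tac).
  cycle_tac.
- have /negP[] := noc
    (x1 :: r ++ (y1 :: A1) ++ [:: x2, u2, y2 & A2] ++ [:: u1]) ltac:(perm_tac).
  cycle_tac.
- have /negP[] := noc
    (x1 :: r ++ rev (y2 :: A2) ++ [:: u2; x2] ++ rev (y1 :: A1) ++ [:: u1])
    ltac:(perm_tac).
  cycle_tac.
Qed.

(** * From a cycle with an ear to a frame *)

Definition eared_cycle (G : sgraph) (x1 : G) Q1 (x2 : G) Q2 s : Prop :=
  [/\ path (@adj G) x1 (rcons Q1 x2), path (@adj G) x2 (rcons Q2 x1),
      no_extension ((x1 :: Q1) ++ (x2 :: Q2)),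
      ear ((x1 :: Q1) ++ (x2 :: Q2)) x1 s x2
    & all (fun z => ~~ heavy z) s].

Lemma eared_cycle_swap (G : sgraph) (x1 x2 : G) Q1 Q2 s :
  eared_cycle x1 Q1 x2 Q2 s -> eared_cycle x2 Q2 x1 Q1 (rev s).
Proof.
case=> p1 p2 ne es hs; split=> //; last by rewrite all_rev.
  by apply: eq_no_extension ne; apply: perm_mem; rewrite perm_catC.
by apply: ear_rev es; rewrite perm_catC.
Qed.

(** Otherwise [x1] and [x2] are consecutive and the ear can be inserted between them. *)
Lemma eared_cycle_neq_nil (G : sgraph) (x1 x2 : G) Q1 Q2 s :
  eared_cycle x1 Q1 x2 Q2 s -> Q1 <> [::].
Proof.
case=> _ p2 ne [s0 us ps ls] _ Q1E; subst Q1.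
have /negP[] := no_extension_cycle ne us s0 (c := x1 :: s ++ x2 :: Q2)
  ltac:(perm_tac).
rewrite /= rcons_cat cat_path /= adj_hadj //.
by rewrite !(sub_path (@adj_hadj G)).
Qed.

(** The first ear vertex [z] is adjacent to neither cycle neighbour of [x1], or it could be inserted
    beside [x1]. The claw condition at [x1] then joins these two neighbours, so [x1] can be
    skipped. *)
Lemma eared_cycle_bypass (G : sgraph) (x1 x2 q1 : G) Q1 Q2 s :
  fheavy claw G -> eared_cycle x1 (q1 :: Q1) x2 Q2 s ->
  hadj (last x2 Q2) q1.
Proof.
move=> hC ec; have := eared_cycle_neq_nil (eared_cycle_swap ec).
case: ec => p1 p2 ne [s0 us ps ls] hs; case: Q2 p2 ne us => // q2 Q2 p2 ne us _.
case: s s0 us ps ls hs => // z s _ us /= /andP[xz _] _ /andP[nz _].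
have us1 : uniq (((x1 :: q1 :: Q1) ++ (x2 :: q2 :: Q2)) ++ [:: z]).
  by move: us; rewrite -[z :: s]cat1s catA [uniq (_ ++ s)]cat_uniq;
    case/andP.
have noc := no_extension_cycle ne us1 erefl.
have lQ : last q2 Q2 \in q2 :: Q2 := mem_last q2 Q2.
have h1 : path (@hadj G) x1 (rcons (q1 :: Q1) x2) := sub_path (@adj_hadj G) p1.
have h2 : path (@hadj G) x2 (rcons (q2 :: Q2) x1) := sub_path (@adj_hadj G) p2.
have hxz : hadj x1 z by apply: adj_hadj.
move: h1 h2; rewrite /= !rcons_path => /and3P[xq1 h1 l1] /and3P[xq2 h2 l2].
have zq : ~~ adj z q1.
  apply/negP => /adj_hadj bad.
  have /negP[] := noc ([:: x1, z, q1 & Q1] ++ [:: x2, q2 & Q2]) ltac:(perm_tac).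
  cycle_tac.
have zl : ~~ adj z (last q2 Q2).
  apply/negP => /adj_hadj bad.
  have /negP[] := noc (z :: [:: x1, q1 & Q1] ++ [:: x2, q2 & Q2]) ltac:(perm_tac).
  cycle_tac.
have disj : forall w, w \in (x1 :: q1 :: Q1) ++ (x2 :: q2 :: Q2) -> z != w.
  move=> w wW; apply: contraTneq us1 => ->.
  by rewrite cats1 rcons_uniq wW.
apply: (claw_hadj (c := x1) (a := z)) => //.
- move: p2; rewrite /= rcons_path => /and3P[_ _ +].
  by rewrite adj_sym.
- by move: p1 => /= /andP[].
- move: us; rewrite !cat_uniq => /andP[/and3P[_ /hasPn h _] _].
  have := h (last q2 Q2); rewrite inE lQ orbT => /(_ isT).
  by rewrite !inE !negb_or => /and3P[].
- by apply: disj; rewrite mem_cat [_ \in x2 :: _]inE lQ !orbT.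
- by apply: disj; rewrite mem_cat !inE eqxx !orbT.
Qed.

Lemma split_first_false (T : Type) (a : pred T) s : ~~ all a s ->
  exists s1 y s2, [/\ s = s1 ++ y :: s2, all a s1 & ~~ a y].
Proof.
elim: s => //= x s IHs; have [ax /= nas|nax _] := boolP (a x).
  have [s1 [y [s2 [-> as1 ny]]]] := IHs nas.
  by exists (x :: s1), y, s2; rewrite /= ax.
by exists [::], x, s.
Qed.

(** If [x1] were adjacent to all of [Q1], in particular to its last vertex, then [x1], the ear,
    [x2], [Q2], the bypass of [x1] and [Q1] would form a larger cycle. The first nonneighbour [y]
    has a predecessor in [Q1], as [Q1] starts with a neighbour. *)
Lemma eared_cycle_split (G : sgraph) (x1 x2 : G) Q1 Q2 s :
  fheavy claw G -> eared_cycle x1 Q1 x2 Q2 s ->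
  exists P u y A, [/\ Q1 = P ++ [:: u, y & A], all (@adj G x1) P, adj x1 u,
    ~~ adj x1 y & path (@hadj G) (last x2 Q2) Q1].
Proof.
move=> hC ec; have := eared_cycle_neq_nil ec.
case: Q1 ec => // q1 Q1 ec _.
have bp := eared_cycle_bypass hC ec.
case: ec => p1 p2 ne [s0 us ps ls] _.
have p1' : path (@adj G) x1 (q1 :: Q1).
  by move: p1; rewrite rcons_path => /andP[].
have hQ1 : path (@hadj G) (last x2 Q2) (q1 :: Q1).
  by rewrite /= bp; case/andP: p1' => _ /(sub_path (@adj_hadj G)).
have nall : ~~ all (@adj G x1) (q1 :: Q1).
  apply/negP => /allP al.
  have hps : path (@hadj G) x1 s := sub_path (@adj_hadj G) ps.
  have hp2 : path (@hadj G) x2 Q2.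
    apply: (sub_path (@adj_hadj G)).
    by move: p2; rewrite rcons_path => /andP[].
  have hl : hadj (last x1 s) x2 by apply: adj_hadj.
  have ha : hadj (last q1 Q1) x1.
    by apply: adj_hadj; rewrite adj_sym; apply: al; apply: mem_last.
  move: hQ1 => /= /andP[hb hQ1].
  have /negP[] := no_extension_cycle ne us s0
    (c := x1 :: s ++ (x2 :: Q2) ++ (q1 :: Q1)) ltac:(perm_tac).
  cycle_tac.
have [s1 [y [A [QE as1 ny]]]] := split_first_false nall.
case/lastP: s1 QE as1 => [[? _] _|P u QE].
  by subst y; move: p1' ny => /= /andP[->].
rewrite all_rcons => /andP[xu aP].
by exists P, u, y, A; split=> //; rewrite QE cat_rcons.
Qed.

(* The neighbours P1, P2 of x1, x2 that precede u1, u2 are moved to the other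
   side of x1, x2. *)
Lemma eared_cycle_frame (G : sgraph) (x1 x2 : G) Q1 Q2 s :
  fheavy claw G -> eared_cycle x1 Q1 x2 Q2 s ->
  exists u1 y1 A1 u2 y2 A2,
    [/\ frame x1 u1 y1 A1 x2 u2 y2 A2, ~~ adj x1 y1, ~~ adj x2 y2
      & perm_eq ((x1 :: Q1) ++ (x2 :: Q2))
          ([:: x1, u1, y1 & A1] ++ [:: x2, u2, y2 & A2])].
Proof.
move=> hC ec.
have [P1 [u1 [y1 [A1 [QE1 aP1 xu1 ny1 h1]]]]] := eared_cycle_split hC ec.
have [P2 [u2 [y2 [A2 [QE2 aP2 xu2 ny2 h2]]]]] :=
  eared_cycle_split hC (eared_cycle_swap ec).
(* The bypass of [x2] leads from the end of [A1] into [P2], or straight to [u2] if [P2] is empty;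
   the end of [A1 ++ P2] is adjacent to [x2] in either case. *)
exists u1, y1, (A1 ++ P2), u2, y2, (A2 ++ P1).
have pm : perm_eq ((x1 :: Q1) ++ (x2 :: Q2))
          ([:: x1, u1, y1 & A1 ++ P2] ++ [:: x2, u2, y2 & A2 ++ P1]).
  by rewrite QE1 QE2; perm_tac.
case: ec => p1 p2 ne _ _.
split=> //; split; last by apply: eq_no_extension ne; apply: perm_mem.
all: move: p1 p2 h1 h2; rewrite QE1 QE2 !rcons_cat !last_cat !cat_path /=.
all: rewrite !rcons_path => /and3P[_ _ /and3P[uy1 py1 ly1]].
all: move=> /and3P[_ _ /and3P[uy2 py2 ly2]].
all: move=> /and3P[hP1 lu1 /andP[_ h1]] /and3P[hP2 lu2 /andP[_ h2]].
all: split=> //; first by apply/andP.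
  case/lastP: (P2) aP2 => // P w; rewrite all_rcons last_rcons => /andP[+ _].
  by rewrite adj_sym.
case/lastP: (P1) aP1 => // P w; rewrite all_rcons last_rcons => /andP[+ _].
by rewrite adj_sym.
Qed.

(** * The contradiction from an eared cycle *)

Lemma perm_cat_uniq (T : eqType) (l r m : seq T) :
  perm_eq (l ++ r) m -> uniq m -> uniq l.
Proof. by move=> pm; rewrite -(perm_uniq pm) cat_uniq => /andP[]. Qed.

(** The chord from [last y2 A2] to [u1] is either a heavy pair or an edge; an edge gives an induced
    hourglass centred at [x1] with triangles through [z x2] and [u1 (last y2 A2)], where [z] is
    light. *)
Lemma hourglass_side (G : sgraph) (x1 u1 y1 x2 u2 y2 z : G) A1 A2 s :
  fheavy hourglass G -> frame x1 u1 y1 A1 x2 u2 y2 A2 ->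
  ear ([:: x1, u1, y1 & A1] ++ [:: x2, u2, y2 & A2]) x1 s x2 ->
  z \in s -> ~~ heavy z -> adj x1 x2 -> adj x1 z -> adj z x2 -> heavy u1.
Proof.
move=> hH fr er zs nz xx xz zx.
have [n1 n2 n3] := frame_ear_vertex fr er zs.
have [_ _ _ _ [_ n5]] := frame_exchange fr er.
have [_ n4 _ _ _] := frame_exchange (frame_swap fr)
  (ear_rev (permEl (perm_catC _ _)) er).
case: fr er => [[xu1 uy1 p1 l1 k1] [xu2 uy2 p2 l2 k2] _] [_ us _ _].
move: k2; rewrite {1}/hadj => /orP[wu|/and3P[] //].
have ul : uniq [:: x1; z; x2; u1; last y2 A2].
  case/splitPr: zs us => s1 s2; rewrite (lastI y2 A2).
  apply: (perm_cat_uniq (r := y1 :: A1 ++ u2 :: belast y2 A2 ++ s1 ++ s2)).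
  by rewrite -cats1; perm_tac.
have := hourglass_heavy hH ul; rewrite (negbTE nz) /=; apply.
- by rewrite xz xx zx xu1 adj_sym l2.
- by rewrite adj_sym.
- by rewrite (negbTE n1) (negbTE n3) (hadjN_adj n4) (hadjN_adj n5).
Qed.

(** Induction on the ear length stands in for choosing a shortest ear. *)
Lemma eared_cycle_absurd (G : sgraph) (x1 x2 : G) Q1 Q2 s :
  fheavy claw G -> fheavy P7 G -> fheavy deer G \/ fheavy hourglass G ->
  ~ eared_cycle x1 Q1 x2 Q2 s.
Proof.
move=> hC hP hDH; have [m] := ubnP (size s); elim: m s => // m IH s sm ec.
have [u1 [y1 [A1 [u2 [y2 [A2 [fr ny1 ny2 pW]]]]]]] := eared_cycle_frame hC ec.
set W := _ ++ _ in pW; set W' := _ ++ _ in pW.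
(* If the segment [p2] can be skipped, the rest is a shorter ear on the same cycle. *)
have short p1 p2 p3 : s = p1 ++ p2 ++ p3 -> 0 < size p2 ->
    0 < size (p1 ++ p3) -> path (@adj G) x1 (p1 ++ p3) ->
    adj (last x1 (p1 ++ p3)) x2 -> False.
  move=> sE p2_gt0 s'_gt0 ps' ls'; apply: (IH (p1 ++ p3)).
    by move: sm; rewrite sE !size_cat; lia.
  have sub : subseq (p1 ++ p3) s.
    by rewrite sE cat_subseq // suffix_subseq.
  case: ec => e1 e2 ne [_ us _ _] nh; split=> //; last first.
    by apply/allP=> z /(mem_subseq sub) zs; apply: (allP nh).
  by split=> //; apply: subseq_uniq us; apply: cat_subseq.
case: ec => _ _ _ er hs.
have {}er : ear W' x1 s x2.
  case: er => s0 us ps ls; split=> //.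
  by rewrite -(perm_uniq (perm_cat pW (perm_refl s))).
have er' : ear ([:: x2, u2, y2 & A2] ++ [:: x1, u1, y1 & A1]) x2 (rev s) x1.
  by apply: ear_rev er; rewrite /W' perm_catC.
have [nu nxu1 nyx1 nyu1 [nyy nxw2]] := frame_exchange fr er.
have [_ nxu2 nyx2 nyu2 [_ nxw1]] := frame_exchange (frame_swap fr) er'.
have Z z : z \in s -> [/\ ~~ heavy z, ~~ adj z u1, ~~ adj z y1, ~~ adj z u2
    & ~~ adj z y2].
  move=> zs; have [? ? _] := frame_ear_vertex fr er zs.
  have zs' : z \in rev s by rewrite mem_rev.
  have [? ? _] := frame_ear_vertex (frame_swap fr) er' zs'.
  by split=> //; apply: (allP hs).
have u12 : u1 != u2.
  case: er => _ us _ _; have : uniq [:: u1; u2].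
    apply: (perm_cat_uniq (r := [:: x1, y1 & A1] ++ [:: x2, y2 & A2] ++ s)) us.
    by rewrite /W'; perm_tac.
  by rewrite /= inE andbT.
have notboth : heavy u1 -> heavy u2 -> False.
  by move=> h1 h2; move/negP: nu; apply; apply: heavy_hadj.
have [[xu1 uy1 _ _ _] [xu2 uy2 _ _ _] _] := fr.
have [s0 us ps ls] := er.
have F (a b : G) : ~~ hadj a b -> (adj a b = false) * (adj b a = false).
  by move=> h; rewrite [adj b a]adj_sym (hadjN_adj h).
have N (a b : G) : ~~ adj a b -> (adj a b = false) * (adj b a = false).
  by move=> h; rewrite [adj b a]adj_sym (negbTE h).
have FE := (F _ _ nu, F _ _ nxu1, F _ _ nyx1, F _ _ nyu1, F _ _ nyy,
            F _ _ nxu2, F _ _ nyx2, F _ _ nyu2, N _ _ ny1, N _ _ ny2).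
have [xx|nxx] := boolP (adj x1 x2).
  have [z [s' sE]] : exists z s', s = z :: s'.
    by case: (s) s0 => // z s'; exists z, s'.
  have zs : z \in s by rewrite sE mem_head.
  have xz : adj x1 z by move: ps; rewrite sE => /= /andP[].
  have [nz zu1 zy1 zu2 zy2] := Z z zs.
  have ud : uniq [:: z; x1; x2; u1; y1; u2; y2].
    apply: (perm_cat_uniq (r := A1 ++ A2 ++ s')) us.
    by rewrite sE /W'; perm_tac.
  (* Otherwise the claw condition at [x1] with leaves [z], [x2], [u1] joins [x2] to [u1]. *)
  have zx : adj z x2.
    apply: contraNT nxu2 => nzx.
    apply: (claw_hadj (c := x1) (a := z)) => //.
    - by move: ud; rewrite /= !inE !negb_or => /and4P[_ _ /andP[]].
    - by move: ud; rewrite /= !inE !negb_or => /andP[/and4P[_ ? ? _]].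
    - by move: ud; rewrite /= !inE !negb_or => /andP[/and4P[_ ? ? _]].
  case: hDH => [hD|hH].
    have := deer_heavy hD ud; rewrite (negbTE nz) /=.
    rewrite [adj z x1]adj_sym xz zx xx xu1 uy1 xu2 uy2.
    rewrite (negbTE zu1) (negbTE zy1) (negbTE zu2) (negbTE zy2) !FE.
    by move=> /(_ isT isT isT isT isT isT) /andP[]; apply: notboth.
  apply: notboth.
    exact: (hourglass_side hH fr er zs).
  apply: (hourglass_side hH (frame_swap fr) er' (z := z)) => //;
    by rewrite ?mem_rev // adj_sym.
have {nxx} nxx := N _ _ nxx.
(* A chord of the ear yields a shorter ear, excluded by the induction. *)
case: s => [|z1 [|z2 [|z3 r]]] // in sm short hs er er' Z s0 us ps ls *.
(* One interior vertex: the light [z1] is at distance 2 from both [u1] and [u2] on the P7. *)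
- have [nz zu1 zy1 zu2 zy2] := Z z1 (mem_head _ _).
  have ud : uniq [:: y1; u1; x1; z1; x2; u2; y2].
    apply: (perm_cat_uniq (r := A1 ++ A2)) us.
    by rewrite /W'; perm_tac.
  have := P7_heavy hP ud; rewrite (negbTE nz) /=.
  move: ps ls => /= /andP[xz _] zx.
  rewrite [adj y1 u1]adj_sym [adj u1 x1]adj_sym xz zx uy1 xu1 uy2 xu2.
  rewrite !FE !(N _ _ zu1, N _ _ zy1, N _ _ zu2, N _ _ zy2, nxx).
  move=> /(_ isT isT isT isT isT) []; rewrite orbF => h1 h2 _.
  exact: notboth.
(* Two interior vertices: the P7 stops at [u2], and the pairs [u1], [z1] and [z2], [u2] make both
   [u1] and [u2] heavy. *)
- have [nz1 z1u1 z1y1 z1u2 z1y2] := Z z1 (mem_head _ _).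
  have [nz2 z2u1 z2y1 z2u2 z2y2] := Z z2 ltac:(by rewrite !inE eqxx orbT).
  have ud : uniq [:: y1; u1; x1; z1; z2; x2; u2].
    apply: (perm_cat_uniq (r := y2 :: A1 ++ A2)) us.
    by rewrite /W'; perm_tac.
  move: ps ls => /= /and3P[xz1 z12 _] z2x.
  have xz2 : ~~ adj x1 z2.
    by apply/negP => bad; apply: (short [::] [:: z1] [:: z2]); rewrite //= ?bad.
  have z1x : ~~ adj z1 x2.
    by apply/negP => bad; apply: (short [:: z1] [:: z2] [::]); rewrite //= ?xz1.
  have := P7_heavy hP ud.
  rewrite [adj y1 u1]adj_sym [adj u1 x1]adj_sym xz1 z12 z2x uy1 xu1 xu2.
  rewrite !FE !(N _ _ z1u1, N _ _ z1y1, N _ _ z1u2, N _ _ z2u1, N _ _ z2y1,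
    N _ _ z2u2, N _ _ xz2, N _ _ z1x, nxx) /=.
  move=> /(_ isT isT isT isT isT) [h1 _ h2].
  by apply: notboth; [move: h1 | move: h2];
    rewrite ?(negbTE nz1) ?(negbTE nz2) ?orbF.
have [nz1 z1u1 z1y1 _ _] := Z z1 (mem_head _ _).
have [_ z2u1 z2y1 _ _] := Z z2 ltac:(by rewrite !inE eqxx orbT).
have [nz3 z3u1 z3y1 _ _] := Z z3 ltac:(by rewrite !inE eqxx !orbT).
move: ps ls => /= /and4P[xz1 z12 z23 pr] lr.
have xz2 : ~~ adj x1 z2.
  by apply/negP => bad; apply: (short [::] [:: z1] [:: z2, z3 & r]);
    rewrite //= ?bad ?z23.
have xz3 : ~~ adj x1 z3.
  by apply/negP => bad; apply: (short [::] [:: z1; z2] [:: z3 & r]);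
    rewrite //= ?bad.
have z13 : ~~ adj z1 z3.
  by apply/negP => bad; apply: (short [:: z1] [:: z2] [:: z3 & r]);
    rewrite //= ?xz1 ?bad.
(* At least three: [t] follows [z3], being [x2] or a fourth ear vertex. The pair [z1], [z3] on the
   P7 is light, a contradiction. *)
have [t [ud z3t xt z1t [z2t [tu1 ty1]]]] : exists t,
  [/\ uniq [:: y1; u1; x1; z1; z2; z3; t], adj z3 t, ~~ adj x1 t, ~~ adj z1 t
    & ~~ adj z2 t /\ ~~ adj t u1 /\ ~~ adj t y1].
  case: r => [|t r] in sm short hs er er' Z s0 us pr lr *.
    exists x2; split.
    - apply: (perm_cat_uniq (r := [:: y2, u2 & A1 ++ A2])) us.
      by rewrite /W'; perm_tac.
    - by [].
    - by rewrite nxx.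
    - by apply/negP => bad; apply: (short [:: z1] [:: z2; z3] [::]);
        rewrite //= ?xz1.
    - split; last by rewrite !FE.
      by apply/negP => bad; apply: (short [:: z1; z2] [:: z3] [::]);
        rewrite //= ?xz1 ?z12.
  have [_ ? ? _ _] := Z t ltac:(by rewrite !inE eqxx !orbT).
  case/andP: pr => z3t pr.
  exists t; split=> //.
  - apply: (perm_cat_uniq (r := [:: x2, y2, u2 & A1 ++ A2] ++ r)) us.
    by rewrite /W'; perm_tac.
  - by apply/negP => bad; apply: (short [::] [:: z1; z2; z3] [:: t & r]);
      rewrite //= ?bad.
  - by apply/negP => bad; apply: (short [:: z1] [:: z2; z3] [:: t & r]);
      rewrite //= ?xz1 ?bad.
  - split=> //.
    by apply/negP => bad; apply: (short [:: z1; z2] [:: z3] [:: t & r]);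
      rewrite //= ?xz1 ?z12 ?bad.
have := P7_heavy hP ud.
rewrite [adj y1 u1]adj_sym [adj u1 x1]adj_sym xz1 z12 z23 z3t uy1 xu1.
rewrite !FE !(N _ _ z1u1, N _ _ z1y1, N _ _ z2u1, N _ _ z2y1, N _ _ z3u1,
  N _ _ z3y1, N _ _ xz2, N _ _ xz3, N _ _ z13, N _ _ xt, N _ _ z1t, N _ _ z2t,
  N _ _ tu1, N _ _ ty1) /=.
move=> /(_ isT isT isT isT isT) [_ h _].
by move: h; rewrite (negbTE nz1) (negbTE nz3).
Qed.

(** * Cycles and ears from 2-connectedness *)

(** Connectedness of the complement of [X] as an induction principle, used below mostly with
    reachability for [R]. *)
Lemma k_connected2_closed (G : sgraph) (X : {set G}) (R : pred G) v w :
  k_connected 2 G -> #|X| < 2 -> v \notin X -> w \notin X -> R v ->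
  (forall a b, R a -> adj a b -> b \notin X -> R b) -> R w.
Proof.
move=> [_ conn] cX vX wX Rv cl.
have vC : v \in ~: X by rewrite inE.
have wC : w \in ~: X by rewrite inE.
have /connectP[p pp wE] := conn X cX (Sub v vC) (Sub w wC).
suff h : R (val (last (Sub v vC : induced (~: X)) p)) by rewrite -wE in h.
move: (Sub v vC : induced (~: X)) (Rv : R (val (Sub v vC : induced (~: X)))) pp.
elim: p {wE} => //= b p IH a Ra /andP[ab pp]; apply: IH => //.
apply: cl Ra ab _; by have := valP b; rewrite inE.
Qed.

(** Otherwise [u] would be isolated once [v] is removed, although a third vertex exists. *)
Lemma k_connected2_neighbor (G : sgraph) (u v : G) :
  k_connected 2 G -> u != v -> exists2 w, adj u w & w != v.
Proof.
move=> hG uv; have [n3 _] := hG.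
have [/existsP[w /andP[uw wv]]|no] := boolP [exists w, adj u w && (w != v)].
  by exists w.
have /card_gt0P[w] : 0 < #|~: [set u; v]|.
  by have := cardsC [set u; v]; rewrite cards2 uv; move: n3; lia.
rewrite !inE negb_or => /andP[wu wv].
suff : w == u by rewrite (negbTE wu).
apply: (k_connected2_closed (X := [set v]) (R := pred1 u) (v := u)) => //.
- by rewrite cards1.
- by rewrite !inE.
- by rewrite !inE.
- exact: eqxx.
move=> a b /eqP-> ub; rewrite inE => bv.
by move/negP: no; case; apply/existsP; exists b; rewrite ub.
Qed.

(** A second neighbour [w] of [u] reaches [v] by a path avoiding [u], which the pair [u], [v]
    closes. *)
Lemma hadj_edge_cycle (G : sgraph) (u v : G) :
  k_connected 2 G -> hadj u v -> u != v ->
  exists c, [/\ uniq c, 2 < size c, cycle (@hadj G) c, u \in c & v \in c].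
Proof.
move=> hG huv uv; have [w uw wv] := k_connected2_neighbor hG uv.
pose e := [rel x y | adj x y && (y != u)].
have wu : w != u by rewrite eq_sym adj_neq.
have /connectP[p0 pp0 vE] : connect e w v.
  apply: (k_connected2_closed (X := [set u]) (R := connect e w) (v := w)) => //.
  - by rewrite cards1.
  - by rewrite inE.
  - by rewrite inE eq_sym.
  move=> a b wa ab; rewrite inE => bu; apply: connect_trans wa (connect1 _).
  by rewrite /= ab.
case/shortenP: pp0 vE => p pe upp _ vE.
have pa : path (@hadj G) w p by apply: sub_path pe => x y /andP[/adj_hadj].
have unp : u \notin p.
  elim: (p) (w) pe => //= b q IH a /andP[/andP[_ bu] /IH].
  by rewrite inE negb_or eq_sym bu.
exists [:: u, w & p]; split.
- by rewrite cons_uniq inE negb_or eq_sym wu unp.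
- by case: (p) vE => // vE; rewrite vE eqxx in wv.
- by rewrite /= (adj_hadj uw) rcons_path pa -vE hadj_sym.
- exact: mem_head.
- by rewrite inE vE mem_last orbT.
Qed.

(** Three or more heavy vertices form an [hadj]-clique, so any enumeration of them is a cycle; at
    most two lie on one [hadj]-edge. *)
Lemma heavy_cycle (G : sgraph) : k_connected 2 G ->
  exists c : seq G, [/\ uniq c, 2 < size c, cycle (@adj G) c
    & {subset @heavy G <= c}].
Proof.
move=> hG.
suff [c [uc sc cc sub]] : exists c : seq G,
    [/\ uniq c, 2 < size c, cycle (@hadj G) c & {subset @heavy G <= c}].
  have [c' [uc' cc' sub']] := hadj_cycle sc uc cc.
  exists c'; split=> //; last by move=> x /sub /sub'.
  by apply: leq_trans sc (uniq_leq_size uc sub').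
have [big|small] := ltnP 2 #|[pred x | @heavy G x]|.
  exists (enum [pred x | @heavy G x]); split.
  - exact: enum_uniq.
  - by rewrite -cardE.
  - apply: cycle_from_next; first exact: enum_uniq.
    move=> x xc; set y := next _ x.
    have yc : y \in enum [pred x | @heavy G x] by rewrite mem_next.
    move: (xc) (yc); rewrite !mem_enum !inE => hx hy.
    apply: heavy_hadj => //; apply/eqP => xy.
    move: (enum_uniq [pred x | @heavy G x]) big; rewrite cardE.
    have [i p rc] := rot_to xc => ue; rewrite -(size_rot i).
    have := next_rot i ue x; rewrite -/y -xy rc; rewrite -(rot_uniq i) rc in ue.
    case: p ue {rc} => [|b p] //=; rewrite eqxx => /andP[+ _] bx.
    by rewrite bx inE eqxx.
  - by move=> x hx; rewrite mem_enum inE.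
have [u [v [uv huv sub]]] : exists u v : G,
   [/\ u != v, hadj u v & forall x, heavy x -> x \in [:: u; v]].
  have [n3 _] := hG.
  case E : (enum [pred x | @heavy G x]) => [|u [|v [|w l]]].
  - have /card_gt0P[u _] : 0 < #|G| by apply: leq_trans n3.
    have /card_gt0P[w] : 0 < #|~: [set u]|.
      by have := cardsC [set u]; rewrite cards1; move: n3; lia.
    rewrite !inE eq_sym => uw.
    have [v uv _] := k_connected2_neighbor hG uw.
    exists u, v; split; [exact: adj_neq | exact: adj_hadj |].
    move=> x hx; have : x \in enum [pred x | @heavy G x] by rewrite mem_enum.
    by rewrite E.
  - have /card_gt0P[w] : 0 < #|~: [set u]|.
      by have := cardsC [set u]; rewrite cards1; move: n3; lia.
    rewrite !inE eq_sym => uw.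
    have [v uv _] := k_connected2_neighbor hG uw.
    exists u, v; split; [exact: adj_neq | exact: adj_hadj |].
    move=> x hx; have : x \in enum [pred x | @heavy G x] by rewrite mem_enum.
    by rewrite E !inE => ->.
  - have := enum_uniq [pred x | @heavy G x]; rewrite E /= inE andbT => uv.
    have hv x : (x \in [:: u; v]) = heavy x by rewrite -E mem_enum.
    exists u, v; split=> //; last by move=> x; rewrite hv.
    by apply: heavy_hadj => //; rewrite -hv !inE eqxx ?orbT.
  - by move: small; rewrite cardE E.
have [c [uc sc cc uin vin]] := hadj_edge_cycle hG huv uv.
by exists c; split=> // x /sub; rewrite !inE => /orP[]/eqP->.
Qed.

(** [N] collects the attachments on [c] of the component of [v] off [c]. With fewer than two,
    removing [N] would separate [v] from the rest of [c]. *)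
Lemma ear_exists (G : sgraph) (c : seq G) v :
  k_connected 2 G -> uniq c -> 1 < size c -> v \notin c ->
  exists x1 x2 s, [/\ x1 \in c, x2 \in c, x1 != x2 & ear c x1 s x2].
Proof.
move=> hG uc sc vc.
pose e := [rel x y | adj x y && (y \notin c)].
have Rc w : connect e v w -> w \notin c.
  case/connectP => p pp ->.
  by elim: p v vc pp => //= b p IH a _ /andP[/andP[_ bc] pp]; apply: IH.
pose N := [set x in c | [exists w, connect e v w && adj w x]].
have [lt2|/card_gt1P[x1 [x2 [x1N x2N x12]]]] := ltnP #|N| 2.
  have [w wc wN] : exists2 w, w \in c & w \notin N.
    case: c uc sc {vc e Rc} N lt2 => [|a [|b c]] //= uc _ N lt2.
    have [aN|] := boolP (a \in N); last by exists a; rewrite ?mem_head.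
    have [bN|] := boolP (b \in N); last by exists b; rewrite ?inE ?eqxx ?orbT.
    have : [set a; b] \subset N by rewrite subUset !sub1set aN.
    move/subset_leq_card; rewrite cards2.
    by move: uc lt2; rewrite inE negb_or => /andP[/andP[-> _] _]; lia.
  suff /Rc : connect e v w by rewrite wc.
  apply: (k_connected2_closed (X := N) (R := connect e v) (v := v)) => //.
    by rewrite inE (negbTE vc).
  move=> a b va ab; rewrite inE => nb.
  apply: connect_trans (va) (connect1 _); rewrite /= ab /=.
  apply: contra nb => ->; apply/existsP; exists a; by rewrite va.
move: x1N x2N; rewrite !inE => /andP[x1c /existsP[w1 /andP[vw1 wx1]]].
move=> /andP[x2c /existsP[w2 /andP[vw2 wx2]]].
(* The relation [e] is not symmetric, but a walk from [v] stays off [c] and can be reversed. *)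
have symR w : connect e v w -> connect e w v.
  case/connectP => p pp ->; elim: p v vc pp {Rc N vw1 vw2} => //= b p IH a ac.
  move=> /andP[/andP[ab bc] pp]; apply: connect_trans (IH b bc pp) (connect1 _).
  by rewrite /= adj_sym ab.
have /connectP[p pp lE] := connect_trans (symR _ vw1) vw2.
case/shortenP: pp lE => {}p pp up _ lE.
exists x1, x2, (w1 :: p); split=> //; split=> //.
- rewrite cat_uniq uc up andbT; apply/hasPn => z; rewrite inE => /orP[/eqP->|zp].
    exact: Rc.
  case/splitPr: zp pp {up lE} => p1 p2; rewrite cat_path => /andP[_ /=].
  by case/andP => /andP[].
- rewrite /= adj_sym wx1; by apply: sub_path pp => a b /andP[].
- by rewrite /= -lE.
Qed.

Theorem theorem5 (G : sgraph) (hG : k_connected 2 G)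
  (hheavy : family_fheavy [:: claw; P7; deer] G \/
            family_fheavy [:: claw; P7; hourglass] G) :
  hamiltonian G.
Proof.
have [hC hP hDH] : [/\ fheavy claw G, fheavy P7 G
    & fheavy deer G \/ fheavy hourglass G].
  by case: hheavy => h; split; [ | | left | | | right]; apply: h; rewrite /=;
    tauto.
have [c0 [uc0 sc0 cc0 sub0]] := heavy_cycle hG.
pose good (c : seq G) := [&& uniq c, 2 < size c, cycle (@adj G) c
  & [forall x, heavy x ==> (x \in c)]].
pose P k := [exists t : k.-tuple G, good t].
have goodP c : good c -> P (size c).
  by move=> gc; apply/existsP; exists (in_tuple c).
have exP : exists k, P k.
  exists (size c0); apply: goodP; rewrite /good uc0 sc0 cc0 /=.
  by apply/forallP => x; apply/implyP => /sub0.
have ubP k : P k -> k <= #|G|.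
  case/existsP => t /andP[ut _].
  by rewrite -(size_tuple t) -(card_uniqP ut) max_card.
case: (ex_maxnP exP ubP) => k /existsP[t gt] kmax.
have {kmax} kmax c : good c -> size c <= size t.
  by move=> /goodP /kmax; rewrite size_tuple.
move: (tval t) gt kmax => c /and4P[uc sc cc /forallP hc] kmax.
have [/allP all_c|] := boolP (all (mem c) (enum G)).
  exists c; split=> //; first by rewrite /ucycle cc.
  by move=> x; apply: all_c; rewrite mem_enum.
case/allPn => v _ vc; exfalso.
(* A larger [hadj]-cycle would turn into a larger cycle of G that still contains all heavy
   vertices. *)
have ne : no_extension c.
  move=> d z ud cd sub zd; apply/negPn/negP => zc.
  have lt : size c < size d.
    apply: (@uniq_leq_size _ (z :: c)); first by rewrite /= zc.
    by move=> w; rewrite inE => /orP[/eqP->|/sub].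
  have [d' [ud' cd' sub']] := hadj_cycle (leq_trans sc (ltnW lt)) ud cd.
  have ld := uniq_leq_size ud sub'.
  have : size d' <= size c.
    apply: kmax; rewrite /good ud' cd' (leq_trans _ ld) ?(leq_trans sc (ltnW lt)) //=.
    by apply/forallP => x; apply/implyP => hx; apply/sub'/sub/(implyP (hc x)).
  by rewrite leqNgt (leq_trans lt ld).
have [x1 [x2 [s [x1c x2c x12 er]]]] := ear_exists hG uc (ltnW sc) vc.
have [i Q rc] := rot_to x1c.
have x2Q : x2 \in Q.
  by move: x2c; rewrite -(mem_rot i) rc inE eq_sym (negbTE x12).
case/splitPr: x2Q rc => Q1 Q2 rc.
apply: (eared_cycle_absurd (x1 := x1) (Q1 := Q1) (x2 := x2) (Q2 := Q2) (s := s))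
  => //.
have pm : perm_eq c ((x1 :: Q1) ++ x2 :: Q2) by rewrite cat_cons -rc perm_sym perm_rot.
have cr : cycle (@adj G) (x1 :: Q1 ++ x2 :: Q2) by rewrite -rc rot_cycle.
have [s0 us ps ls] := er.
split.
- rewrite rcons_path; move: cr.
  by rewrite /= rcons_cat cat_path /= => /and3P[-> ->].
- by move: cr; rewrite /= rcons_cat cat_path /= => /and3P[_ _].
- by apply: eq_no_extension ne; apply: perm_mem.
- split=> //; by rewrite -(perm_uniq (perm_cat pm (perm_refl s))).
apply/allP=> z zs; apply/negP => hz.
move: us; rewrite cat_uniq => /and3P[_ /hasPn/(_ z zs) + _].
by rewrite /= (implyP (hc z)).
Qed.
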